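(* Let $(A,\cdot)$ be a nilalgebra with nilindex $3$. Then $(A,\cdot)$ is an $\mathcal{A}\mathrm{BD}$-algebra if and only if for all $y,z\in A$ $$L_yL_z+L_zL_y = R_yR_z+R_zR_y .$$
   Context: All algebras are over $\mathbb{C}$; an algebra $(A,\cdot)$ is a vector space with a bilinear (not necessarily associative) multiplication. Write $x\circ y = x\cdot y+y\cdot x$. A nilalgebra with nilindex $3$ is an algebra with $(x\cdot x)\cdot x = x\cdot (x\cdot x)=0$ for all $x$. $L_x$ and $R_x$ denote left and right multiplication by $x$: $L_x(t)=x\cdot t$, $R_x(t)=t\cdot x$; products of operators are compositions of maps. An algebra $(A,\cdot)$ is called an $\mathcal{A}\mathrm{BD}$-algebra (algebra of anti-biderivation-type) if for all $x,y,z\in A$: $x\cdot(y\circ z) = -\big((x\cdot y)\circ z+y\circ(x\cdot z)\big)$ and $(y\circ z)\cdot x=-\big((y\cdot x)\circ z+y\circ(z\cdot x)\big)$. *)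

(* Defs.v *)
From mathcomp Require Import all_boot all_algebra.

Set Implicit Arguments.
Unset Strict Implicit.
Unset Printing Implicit Defensive.

Local Open Scope ring_scope.

(* An algebra over a ring K is an lmodType K together with a product
   mul : {bilinear A -> A -> A}; the notions below only use the additive
   structure of A and the underlying function of mul. *)
Section Algebra.
Variables (A : zmodType) (mul : A -> A -> A).

Definition acomm (x y : A) : A := mul x y + mul y x.

Definition lmul (x : A) : A -> A := fun t => mul x t.
Definition rmul (x : A) : A -> A := fun t => mul t x.

Definition is_nil3 : Prop :=
  forall x : A, mul (mul x x) x = 0 /\ mul x (mul x x) = 0.

Definition is_ABD : Prop :=
  forall x y z : A,
    mul x (acomm y z) = - (acomm (mul x y) z + acomm y (mul x z)) /\
    mul (acomm y z) x = - (acomm (mul y x) z + acomm y (mul z x)).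

End Algebra.

(* Main.v *)
(* Polarizing the two nil identities gives
     (x∘y)z + (y∘z)x + (z∘x)y = 0   and   x(y∘z) + y(z∘x) + z(x∘y) = 0.
   Using them to eliminate (y∘z)x and x(y∘z), each of the two identities
   defining an ABD-algebra reduces to
     y(zx) + z(yx) = (xz)y + (xy)z,
   which is the operator identity evaluated at x. *)
Require Import Defs.
From mathcomp Require Import all_boot all_algebra sesquilinear complex reals.

Import GRing.Theory.

Local Open Scope ring_scope.
Local Open Scope complex_scope.

(** Linearizing the cube twice yields the trilinear sum with no division by an integer. Keeping [m]
    a bare biadditive map lets the lemma serve the opposite product as well. *)
Lemma nil3_polarized (A : zmodType) (m : A -> A -> A)
    (mDl : forall x y z, m (x + y) z = m x z + m y z)
    (mDr : forall x y z, m x (y + z) = m x y + m x z) :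
  (forall x, m (m x x) x = 0) ->
  forall x y z, m (acomm m x y) z + m (acomm m y z) x + m (acomm m z x) y = 0.
Proof.
move=> nil.
(* [P x y] is the part of the cube of [x + y] that is quadratic in [x] and linear in [y]. *)
pose P x y := m (m x x) y + m (acomm m x y) x.
have acommDl x y z : acomm m (x + y) z = acomm m x z + acomm m y z.
  by rewrite /acomm mDl mDr addrACA.
have sqD x y : m (x + y) (x + y) = m x x + m y y + acomm m x y.
  by rewrite mDl !mDr [LHS](AC (2*2) ((1*4)*(2*3))).
have acommC x y : acomm m x y = acomm m y x by rewrite /acomm addrC.
have PC x y : P x y + P y x = 0.
  have := nil (x + y).
  rewrite sqD 2!mDl !mDr !nil add0r addr0 => <-.
  by rewrite /P [acomm m y x]acommC addrACA.
have PDr x y z : P x (y + z) = P x y + P x z.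
  by rewrite /P acommC acommDl ![acomm m _ x]acommC mDr mDl addrACA.
have PDl x z y : P (x + z) y = P x y + P z y
    + (m (acomm m x y) z + m (acomm m y z) x + m (acomm m z x) y).
  rewrite /P sqD acommDl 3!mDl !mDr [acomm m z x]acommC [acomm m y z]acommC.
  by rewrite [LHS](AC (3*(2*2)) ((1*4)*(2*7)*(5*6*3))).
(* The trilinear sum is the failure of [P] to be additive in its first argument; all other terms
   cancel in pairs by [PC]. *)
move=> x y z; have := PC (x + z) y.
by rewrite PDl PDr addrAC [X in X + _]addrACA !PC !add0r.
Qed.

Theorem proposition18 (R : realType) (A : lmodType R[i])
    (mul : {bilinear A -> A -> A}) (Hnil : is_nil3 mul) :
  is_ABD mul <->
  forall y z : A,
    (lmul mul y \o lmul mul z) \+ (lmul mul z \o lmul mul y)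
    =1 (rmul mul y \o rmul mul z) \+ (rmul mul z \o rmul mul y).
Proof.
have mDl x y z : mul (x + y) z = mul x z + mul y z by rewrite linearDl.
have mDr x y z : mul x (y + z) = mul x y + mul x z by rewrite linearDr.
have polL x y z : mul (acomm mul y z) x
    = - (mul (acomm mul x y) z + mul (acomm mul z x) y).
  apply/eqP; rewrite -addr_eq0 addrCA addrA; apply/eqP.
  by apply: nil3_polarized => // t; case: (Hnil t).
have polR x y z : mul x (acomm mul y z)
    = - (mul z (acomm mul x y) + mul y (acomm mul z x)).
  apply/eqP; rewrite -addr_eq0 addrCA addrA; apply/eqP.
  (* The opposite product turns [t(tt) = 0] into the left form, but swaps the summands of each
     [acomm]. *)
  have := @nil3_polarized A (fun a b => mul b a)
    (fun a b c => mDr c a b) (fun a b c => mDl b c a)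
    (fun t => (Hnil t).2) x y z.
  by rewrite /acomm [mul y x + _]addrC [mul z y + _]addrC [mul x z + _]addrC.
have ABD_left x y z :
    mul x (acomm mul y z) = - (acomm mul (mul x y) z + acomm mul y (mul x z))
    <-> mul y (mul z x) + mul z (mul y x) = mul (mul x z) y + mul (mul x y) z.
  (* The regrouping isolates [z(xy) + y(xz)], common to both sides. *)
  rewrite polR /acomm !mDr [X in - X = _](AC (2*2) ((1*4)*(3*2))).
  rewrite [X in _ = - X](AC (2*2) ((2*3)*(4*1))).
  by split=> [/oppr_inj/addrI | E] //; congr (- (_ + _)).
have ABD_right x y z :
    mul (acomm mul y z) x = - (acomm mul (mul y x) z + acomm mul y (mul z x))
    <-> mul y (mul z x) + mul z (mul y x) = mul (mul x z) y + mul (mul x y) z.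
  (* Here the common part is [(yx)z + (zx)y]. *)
  rewrite polL /acomm !mDl [X in - X = _](AC (2*2) ((2*3)*(4*1))).
  rewrite [X in _ = - X](AC (2*2) ((1*4)*(3*2))).
  by split=> [/oppr_inj/addrI | E] //; congr (- (_ + _)).
split=> [ABD y z x | LR x y z].
  by apply/ABD_left; case: (ABD x y z).
by split; [apply/ABD_left | apply/ABD_right]; exact: LR.
Qed.
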